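(* The system $\mathsf{DG}+(\exists^{2})^{\mathrm{st}}$ is inconsistent, where $(\exists^2)$ is the statement $(\exists\varphi^{2})(\forall f^{1})\big[(\exists n^{0})(f(n)=0)\leftrightarrow\varphi(f)=0\big]$ and $(\exists^2)^{\mathrm{st}}$ is $(\exists^{\mathrm{st}}\varphi^{2})(\forall^{\mathrm{st}} f^{1})\big[(\exists^{\mathrm{st}} n^{0})(f(n)=0)\leftrightarrow\varphi(f)=0\big]$.
   Context: Finite types: $0$ is a type and if $\rho,\sigma$ are types so is $\rho\to\sigma$; type $1=0\to0$, $2=1\to0$. $\mathsf{E\text{-}HA}^{\omega}$ is Heyting arithmetic in all finite types (intuitionistic logic, Gödel's $T$ constants) with extensionality. Equality $=_0$ is primitive; for $\tau=\tau_1\to\dots\to\tau_k\to0$, $x=_\tau y$ abbreviates $(\forall z_1\dots z_k)(xz_1\dots z_k=_0yz_1\dots z_k)$, and $\le_\tau$ likewise. Extensionality $(\mathsf E_{\rho\to\tau})$: $(\forall\varphi)(\forall x,y)(x=_\rho y\to\varphi(x)=_\tau\varphi(y))$, for all types. Strong majorizability (Howard–Bezem): $x\le^*_0 y$ iff $x\le_0 y$; $x\le^*_{\rho\to\sigma}y$ iff for all $u,v$ with $u\le^*_\rho v$: $xu\le^*_\sigma yv$ and $yu\le^*_\sigma yv$. Monotone: $x\le^*x$; $\tilde\forall,\tilde\exists$ range over monotone objects. The language of $\mathsf{DG}$ adds predicates $\mathrm{st}^\sigma$ (''is standard''); $\forall^{\mathrm{st}},\exists^{\mathrm{st}}$ are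 the relativised quantifiers, $\tilde\forall^{\mathrm{st}},\tilde\exists^{\mathrm{st}}$ combine both restrictions. Internal = not containing $\mathrm{st}$. For internal $A$, $A^{\mathrm{st}}$ relativises all quantifiers except bounded number quantifiers to $\mathrm{st}$. $\mathsf{DG}$ is $\mathsf{E\text{-}HA}^\omega$ in the extended language plus: (a) $x=_\sigma y\to(\mathrm{st}(x)\to\mathrm{st}(y))$; (b) $\mathrm{st}(y)\to(x\le^*_\sigma y\to\mathrm{st}(x))$; (c) $\mathrm{st}(t)$ for closed terms $t$; (d) $\mathrm{st}(z)\to(\mathrm{st}(x)\to\mathrm{st}(zx))$; external induction $\Phi(0)\wedge(\forall^{\mathrm{st}}n)(\Phi(n)\to\Phi(n+1))\to(\forall^{\mathrm{st}}n)\Phi(n)$ for any $\Phi$; and for arbitrary $\Phi,\Psi$ and internal $\phi,\psi$: $\mathsf{mAC}^\omega$: $(\tilde\forall^{\mathrm{st}}x)(\tilde\exists^{\mathrm{st}}y)\Phi(x,y)\to(\tilde\exists^{\mathrm{st}}f)(\tilde\forall^{\mathrm{st}}x)(\exists y\le^*f(x))\Phi(x,y)$; $\mathsf R^\omega$: $(\forall x)(\exists^{\mathrm{st}}y)\Phi(x,y)\to(\tilde\exists^{\mathrm{st}}z)(\forall x)(\exists y\le^*z)\Phi(x,y)$; $\mathsf I^\omega$: $(\tilde\forall^{\mathrm{st}}z)(\exists x)(\forall y\le^*z)\phi(x,y)\to(\exists x)(\forall^{\mathrm{st}}y)\phi(x,y)$; $\mathsf{IP}^\omega_{\tilde\forall^{\mathrm{st}}}$: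 $[(\tilde\forall^{\mathrm{st}}x)\phi(x)\to(\tilde\exists^{\mathrm{st}}y)\Psi(y)]\to(\tilde\exists^{\mathrm{st}}z)[(\tilde\forall^{\mathrm{st}}x)\phi(x)\to(\tilde\exists y\le^*z)\Psi(y)]$; $\mathsf M^\omega$: $[(\tilde\forall^{\mathrm{st}}x)\phi(x)\to\psi]\to(\tilde\exists^{\mathrm{st}}y)[(\forall x\le^*y)\phi(x)\to\psi]$; $\mathsf{MAJ}^\omega$: $(\forall^{\mathrm{st}}x)(\exists^{\mathrm{st}}y)(x\le^*y)$. *)

(* Defs.v *)
From Stdlib Require Import List.
Import ListNotations.

Set Implicit Arguments.

(** ** Finite types and terms of Goedel's T *)

Inductive ty : Type :=
| N : ty
| Arr : ty -> ty -> ty.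

Declare Scope ty_scope.
Delimit Scope ty_scope with ty.
Bind Scope ty_scope with ty.
Infix "~>" := Arr (at level 55, right associativity) : ty_scope.

Definition ty1 : ty := (N ~> N)%ty.
Definition ty2 : ty := (ty1 ~> N)%ty.

(* Well-typed de Bruijn syntax: a context lists the types of the free variables,
   most recently bound variable first. *)
Definition ctx : Type := list ty.

Inductive var : ctx -> ty -> Type :=
| vz : forall Γ σ, var (σ :: Γ) σ
| vs : forall Γ τ σ, var Γ σ -> var (τ :: Γ) σ.

Arguments vz {Γ σ}.
Arguments vs {Γ τ σ} _.

(* Combinatory version of Goedel's T: the only binders are the quantifiers. *)
Inductive tm (Γ : ctx) : ty -> Type :=
| Var : forall σ, var Γ σ -> tm Γ σ
| App : forall ρ σ, tm Γ (ρ ~> σ) -> tm Γ ρ -> tm Γ σ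
| Zero : tm Γ N
| Succ : tm Γ (N ~> N)
| Pi : forall ρ σ, tm Γ (ρ ~> σ ~> ρ)
| Sigma : forall ρ σ τ, tm Γ ((ρ ~> σ ~> τ) ~> (ρ ~> σ) ~> ρ ~> τ)
| Rec : forall ρ, tm Γ (N ~> ρ ~> (ρ ~> N ~> ρ) ~> ρ).

Arguments Var {Γ σ} _.
Arguments App {Γ ρ σ} _ _.
Arguments Zero {Γ}.
Arguments Succ {Γ}.
Arguments Pi {Γ ρ σ}.
Arguments Sigma {Γ ρ σ τ}.
Arguments Rec {Γ ρ}.

Declare Scope tm_scope.
Delimit Scope tm_scope with tm.
Bind Scope tm_scope with tm.
Infix "@" := App (at level 40, left associativity) : tm_scope.
Local Open Scope tm_scope.

Definition v0 {Γ σ} : tm (σ :: Γ) σ := Var vz.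
Definition v1 {Γ σ τ} : tm (τ :: σ :: Γ) σ := Var (vs vz).
Definition v2 {Γ σ τ ρ} : tm (ρ :: τ :: σ :: Γ) σ := Var (vs (vs vz)).

(** ** Renaming and substitution in terms *)

Definition renaming (Γ Δ : ctx) : Type := forall σ, var Γ σ -> var Δ σ.
Definition substitution (Γ Δ : ctx) : Type := forall σ, var Γ σ -> tm Δ σ.

Definition var_case (P : ty -> Type) {Γ : ctx} {τ : ty}
    (p0 : P τ) (ps : forall σ, var Γ σ -> P σ) : forall σ, var (τ :: Γ) σ -> P σ :=
  fun σ v =>
    match v in var G σ return
      match G with
      | [] => unit
      | τ' :: Γ' => P τ' -> (forall σ', var Γ' σ' -> P σ') -> P σ
      end
    with
    | vz => fun p0 _ => p0
    | vs w => fun _ ps => ps _ w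
    end p0 ps.

Definition up_ren {Γ Δ τ} (r : renaming Γ Δ) : renaming (τ :: Γ) (τ :: Δ) :=
  var_case (var (τ :: Δ)) vz (fun σ v => vs (r σ v)).

Fixpoint ren_tm {Γ Δ} (r : renaming Γ Δ) {σ} (t : tm Γ σ) : tm Δ σ :=
  match t with
  | Var v => Var (r _ v)
  | App s u => ren_tm r s @ ren_tm r u
  | Zero => Zero
  | Succ => Succ
  | Pi => Pi
  | Sigma => Sigma
  | Rec => Rec
  end.

Definition shift {Γ τ} : renaming Γ (τ :: Γ) := fun _ v => vs v.

Definition lift_tm {Γ τ σ} (t : tm Γ σ) : tm (τ :: Γ) σ := ren_tm shift t.

Definition from_empty (Γ : ctx) : renaming [] Γ :=
  fun σ v =>
    match v in var G σ return match G with [] => var Γ σ | _ => unit end with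
    | vz => tt
    | vs _ => tt
    end.

Definition up_sub {Γ Δ τ} (s : substitution Γ Δ)
    : substitution (τ :: Γ) (τ :: Δ) :=
  var_case (tm (τ :: Δ)) v0 (fun σ v => lift_tm (s σ v)).

Definition single {Γ τ} (t : tm Γ τ) : substitution (τ :: Γ) Γ :=
  var_case (tm Γ) t (fun σ v => Var v).

Fixpoint sub_tm {Γ Δ} (s : substitution Γ Δ) {σ} (t : tm Γ σ) : tm Δ σ :=
  match t with
  | Var v => s _ v
  | App u w => sub_tm s u @ sub_tm s w
  | Zero => Zero
  | Succ => Succ
  | Pi => Pi
  | Sigma => Sigma
  | Rec => Rec
  end.

(** ** Formulas *)

Inductive fm (Γ : ctx) : Type :=
| Bot : fm Γ
| Eq0 : tm Γ N -> tm Γ N -> fm Γ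
| St : forall σ, tm Γ σ -> fm Γ
| And : fm Γ -> fm Γ -> fm Γ
| Or : fm Γ -> fm Γ -> fm Γ
| Imp : fm Γ -> fm Γ -> fm Γ
| All : forall σ, fm (σ :: Γ) -> fm Γ
| Ex : forall σ, fm (σ :: Γ) -> fm Γ.

Arguments Bot {Γ}.
Arguments Eq0 {Γ} _ _.
Arguments St {Γ σ} _.

Declare Scope fm_scope.
Delimit Scope fm_scope with fm.
Bind Scope fm_scope with fm.
Infix "==" := Eq0 (at level 70, no associativity) : fm_scope.
Infix "/\" := And : fm_scope.
Infix "\/" := Or : fm_scope.
Infix "==>" := Imp (at level 90, right associativity) : fm_scope.
Notation "A <==> B" := (And (Imp A B) (Imp B A)) (at level 92, no associativity) : fm_scope.
Local Open Scope fm_scope.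

Fixpoint ren {Γ Δ} (r : renaming Γ Δ) (A : fm Γ) : fm Δ :=
  match A with
  | Bot => Bot
  | Eq0 s t => ren_tm r s == ren_tm r t
  | St t => St (ren_tm r t)
  | And B C => ren r B /\ ren r C
  | Or B C => ren r B \/ ren r C
  | Imp B C => ren r B ==> ren r C
  | @All _ σ B => All (ren (up_ren r) B)
  | @Ex _ σ B => Ex (ren (up_ren r) B)
  end.

Fixpoint sub {Γ Δ} (s : substitution Γ Δ) (A : fm Γ) : fm Δ :=
  match A with
  | Bot => Bot
  | Eq0 t u => sub_tm s t == sub_tm s u
  | St t => St (sub_tm s t)
  | And B C => sub s B /\ sub s C
  | Or B C => sub s B \/ sub s C
  | Imp B C => sub s B ==> sub s C
  | @All _ σ B => All (sub (up_sub s) B)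
  | @Ex _ σ B => Ex (sub (up_sub s) B)
  end.

Definition inst {Γ τ} (A : fm (τ :: Γ)) (t : tm Γ τ) : fm Γ := sub (single t) A.

(* [lift], [lift1] and [lift2] insert one fresh variable of type [ρ], of de
   Bruijn index 0, 1 and 2 respectively. *)
Definition lift {Γ ρ} (A : fm Γ) : fm (ρ :: Γ) := ren shift A.
Definition lift1 {Γ ρ σ} (A : fm (σ :: Γ)) : fm (σ :: ρ :: Γ) :=
  ren (up_ren shift) A.
Definition lift2 {Γ ρ σ τ} (A : fm (τ :: σ :: Γ)) : fm (τ :: σ :: ρ :: Γ) :=
  ren (up_ren (up_ren shift)) A.

(* For [A n] with [n] the last variable, [A (n + 1)]. *)
Definition step {Γ} (A : fm (N :: Γ)) : fm (N :: Γ) := inst (lift1 A) (Succ @ v0).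

Fixpoint internal {Γ} (A : fm Γ) : Prop :=
  match A with
  | Bot | Eq0 _ _ => True
  | St _ => False
  | And B C | Or B C | Imp B C => internal B /\ internal C
  | All B | Ex B => internal B
  end%type.

(** ** Defined relations and quantifiers *)

Fixpoint eqf {Γ} {σ : ty} : tm Γ σ -> tm Γ σ -> fm Γ :=
  match σ return tm Γ σ -> tm Γ σ -> fm Γ with
  | N => fun x y => x == y
  | Arr ρ τ => fun x y => @All Γ ρ (eqf (lift_tm x @ v0) (lift_tm y @ v0))
  end.

(* [predc] is the constant λr.λn. pred r, where pred r = R r 0 (λu.λm. m). *)
Definition idc {Γ σ} : tm Γ (σ ~> σ) := Sigma @ Pi @ (@Pi Γ σ σ).
Definition pred {Γ} : tm Γ (N ~> N) :=
  Sigma @ (Sigma @ Rec @ (Pi @ Zero)) @ (Pi @ (Pi @ idc)).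
Definition predc {Γ} : tm Γ (N ~> N ~> N) := Sigma @ (Pi @ Pi) @ pred.
Definition monus {Γ} (x y : tm Γ N) : tm Γ N := Rec @ y @ x @ predc.

Definition le0 {Γ} (x y : tm Γ N) : fm Γ := monus x y == Zero.

Fixpoint maj {Γ} {σ : ty} : tm Γ σ -> tm Γ σ -> fm Γ :=
  match σ return tm Γ σ -> tm Γ σ -> fm Γ with
  | N => fun x y => le0 x y
  | Arr ρ τ => fun x y =>
      let x' := lift_tm (lift_tm x) in
      let y' := lift_tm (lift_tm y) in
      @All Γ ρ (@All (ρ :: Γ) ρ
        (maj v1 v0 ==> maj (x' @ v1) (y' @ v0) /\ maj (y' @ v1) (y' @ v0)))
  end.

Definition mon {Γ σ} (x : tm Γ σ) : fm Γ := maj x x.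

(* Suffixes: [St] for standard objects, [M] for monotone ones, [MSt] for both;
   [AllMaj t A] and [ExMaj t A] quantify over the objects majorized by [t]. *)
Definition AllSt {Γ} σ (A : fm (σ :: Γ)) : fm Γ := All (St v0 ==> A).
Definition ExSt {Γ} σ (A : fm (σ :: Γ)) : fm Γ := Ex (St v0 /\ A).
Definition AllMSt {Γ} σ (A : fm (σ :: Γ)) : fm Γ := All (mon v0 /\ St v0 ==> A).
Definition ExMSt {Γ} σ (A : fm (σ :: Γ)) : fm Γ := Ex ((mon v0 /\ St v0) /\ A).
Definition AllMaj {Γ σ} (t : tm Γ σ) (A : fm (σ :: Γ)) : fm Γ :=
  All (maj v0 (lift_tm t) ==> A).
Definition ExMaj {Γ σ} (t : tm Γ σ) (A : fm (σ :: Γ)) : fm Γ :=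
  Ex (maj v0 (lift_tm t) /\ A).
Definition ExMMaj {Γ σ} (t : tm Γ σ) (A : fm (σ :: Γ)) : fm Γ :=
  Ex ((mon v0 /\ maj v0 (lift_tm t)) /\ A).

(** ** Intuitionistic derivability from a theory *)

(* An axiom may have free variables; every theory below is given uniformly in
   all contexts. *)
Definition theory : Type := forall Γ, fm Γ -> Prop.

Inductive prv (T : theory) : forall Γ, list (fm Γ) -> fm Γ -> Prop :=
| p_ax : forall Γ (H : list (fm Γ)) A, T Γ A -> prv T H A
| p_hyp : forall Γ (H : list (fm Γ)) A, In A H -> prv T H A
| p_botE : forall Γ (H : list (fm Γ)) A, prv T H Bot -> prv T H A
| p_andI : forall Γ (H : list (fm Γ)) A B,
    prv T H A -> prv T H B -> prv T H (A /\ B)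
| p_andE1 : forall Γ (H : list (fm Γ)) A B, prv T H (A /\ B) -> prv T H A
| p_andE2 : forall Γ (H : list (fm Γ)) A B, prv T H (A /\ B) -> prv T H B
| p_orI1 : forall Γ (H : list (fm Γ)) A B, prv T H A -> prv T H (A \/ B)
| p_orI2 : forall Γ (H : list (fm Γ)) A B, prv T H B -> prv T H (A \/ B)
| p_orE : forall Γ (H : list (fm Γ)) A B C,
    prv T H (A \/ B) -> prv T (A :: H) C -> prv T (B :: H) C -> prv T H C
| p_impI : forall Γ (H : list (fm Γ)) A B, prv T (A :: H) B -> prv T H (A ==> B)
| p_impE : forall Γ (H : list (fm Γ)) A B,
    prv T H (A ==> B) -> prv T H A -> prv T H B
| p_allI : forall Γ (H : list (fm Γ)) σ (A : fm (σ :: Γ)),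
    prv T (map lift H) A -> prv T H (All A)
| p_allE : forall Γ (H : list (fm Γ)) σ (A : fm (σ :: Γ)) (t : tm Γ σ),
    prv T H (All A) -> prv T H (inst A t)
| p_exI : forall Γ (H : list (fm Γ)) σ (A : fm (σ :: Γ)) (t : tm Γ σ),
    prv T H (inst A t) -> prv T H (Ex A)
| p_exE : forall Γ (H : list (fm Γ)) σ (A : fm (σ :: Γ)) (B : fm Γ),
    prv T H (Ex A) -> prv T (A :: map lift H) (lift B) -> prv T H B.

Definition inconsistent (T : theory) : Prop := prv T (@nil (fm [])) Bot.

(* The theory [T + A] for a sentence [A]. *)
Inductive extend (T : theory) (A : fm []) : theory :=
| ext_old : forall Γ B, T Γ B -> extend T A B
| ext_new : forall Γ, extend T A (ren (from_empty Γ) A).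

(** ** The nonlogical axioms *)

(* Equality at higher types is the abbreviation [eqf]; its congruence laws follow
   from extensionality. Induction is for internal formulas: over formulas
   containing [St] it would make every natural number standard. *)
Inductive EHAω : theory :=
| eq_refl0 : forall Γ, @EHAω Γ (@All Γ N (v0 == v0))
| eq_sym0 : forall Γ, @EHAω Γ (@All Γ N (@All _ N (v1 == v0 ==> v0 == v1)))
| eq_trans0 : forall Γ,
    @EHAω Γ (@All Γ N (@All _ N (@All _ N (v2 == v1 ==> v1 == v0 ==> v2 == v0))))
| ext_ax : forall Γ ρ τ,
    @EHAω Γ (@All Γ (ρ ~> τ) (@All _ ρ (@All _ ρ (eqf v1 v0 ==> eqf (v2 @ v1) (v2 @ v0)))))
| succ_nonzero : forall Γ, @EHAω Γ (@All Γ N (Succ @ v0 == Zero ==> Bot))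
| succ_inj : forall Γ,
    @EHAω Γ (@All Γ N (@All _ N (Succ @ v1 == Succ @ v0 ==> v1 == v0)))
| induction : forall Γ (φ : fm (N :: Γ)), internal φ ->
    EHAω (inst φ Zero /\ All (φ ==> step φ) ==> All φ)
| pi_ax : forall Γ ρ σ,
    @EHAω Γ (@All Γ ρ (@All _ σ (eqf (Pi @ v1 @ v0) v1)))
| sigma_ax : forall Γ ρ σ τ,
    @EHAω Γ (@All Γ (ρ ~> σ ~> τ) (@All _ (ρ ~> σ) (@All _ ρ
      (eqf (Sigma @ v2 @ v1 @ v0) (v2 @ v0 @ (v1 @ v0))))))
| rec_zero : forall Γ ρ,
    @EHAω Γ (@All Γ ρ (@All _ (ρ ~> N ~> ρ) (eqf (Rec @ Zero @ v1 @ v0) v1)))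
| rec_succ : forall Γ ρ,
    @EHAω Γ (@All Γ N (@All _ ρ (@All _ (ρ ~> N ~> ρ)
      (eqf (Rec @ (Succ @ v2) @ v1 @ v0) (v0 @ (Rec @ v2 @ v1 @ v0) @ v2))))).

(* In [ax_mAC], [ax_R] and [ax_I] the formula has [x] at index 1 and [y] at index 0. *)
Inductive DG : theory :=
| base : forall Γ A, @EHAω Γ A -> DG A
| st_eq : forall Γ σ,
    @DG Γ (@All Γ σ (@All _ σ (eqf v1 v0 ==> St v1 ==> St v0)))
| st_maj : forall Γ σ,
    @DG Γ (@All Γ σ (@All _ σ (St v0 ==> maj v1 v0 ==> St v1)))
| st_closed : forall Γ σ (t : tm [] σ), @DG Γ (St (ren_tm (from_empty Γ) t))
| st_app : forall Γ σ τ,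
    @DG Γ (@All Γ (σ ~> τ) (@All _ σ (St v1 ==> St v0 ==> St (v1 @ v0))))
| external_induction : forall Γ (Φ : fm (N :: Γ)),
    DG (inst Φ Zero /\ AllSt (Φ ==> step Φ) ==> AllSt Φ)
| ax_mAC : forall Γ σ τ (Φ : fm (τ :: σ :: Γ)),
    DG (AllMSt (ExMSt Φ)
        ==> @ExMSt Γ (σ ~> τ) (AllMSt (ExMaj (v1 @ v0) (lift2 Φ))))
| ax_R : forall Γ σ τ (Φ : fm (τ :: σ :: Γ)),
    DG (All (ExSt Φ) ==> @ExMSt Γ τ (All (ExMaj v1 (lift2 Φ))))
| ax_I : forall Γ σ τ (φ : fm (τ :: σ :: Γ)), internal φ ->
    DG (@AllMSt Γ τ (Ex (AllMaj v1 (lift2 φ))) ==> Ex (AllSt φ))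
| ax_IP : forall Γ σ τ (φ : fm (σ :: Γ)) (Ψ : fm (τ :: Γ)), internal φ ->
    DG ((AllMSt φ ==> ExMSt Ψ)
        ==> ExMSt (AllMSt (lift1 φ) ==> ExMMaj v0 (lift1 Ψ)))
| ax_M : forall Γ σ (φ : fm (σ :: Γ)) (ψ : fm Γ), internal φ -> internal ψ ->
    DG ((AllMSt φ ==> ψ) ==> @ExMSt Γ σ (AllMaj v0 (lift1 φ) ==> lift ψ))
| ax_MAJ : forall Γ σ, @DG Γ (@AllSt Γ σ (@ExSt _ σ (maj v1 v0))).

(* (∃²)^st: (∃st φ)(∀st f)[(∃st n)(f n = 0) <-> φ f = 0]. Under [n], [v1] is f and
   [v0] is n; outside, [v1] is φ and [v0] is f. *)
Definition exists2_st : fm [] :=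
  @ExSt [] ty2 (@AllSt _ ty1
    (@ExSt _ N (v1 @ v0 == Zero) <==> v1 @ v0 == Zero)).

(* Main.v *)
(** For every number [x], standard or not, the function [upto x], which is [1] on
    [0, ..., x] and [0] beyond, is majorized by the constant [1] and is therefore
    standard. If [φ] is a standard [∃²] functional on standard functions, then,
    [φ (upto x) = 0] being decidable, every [x] has a standard [n] such that
    [φ (upto x) = 0] implies [upto x n = 0]. By [ax_R] a single standard [z] bounds
    these [n] for all [x]. Take [x := z]: as [upto z (z + 1) = 0] and [z + 1] is
    standard, [φ (upto z) = 0], so [upto z n = 0] for some [n ≤ z], which is absurd. *)

Require Import Defs.
From Stdlib Require Import List RelationClasses.
From Stdlib Require Setoid Morphisms.
Import ListNotations.
Local Open Scope ty_scope.
Local Open Scope tm_scope.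
Local Open Scope fm_scope.

Arguments lift_tm : simpl never.

(** * Commutation of renaming and substitution *)

Lemma ren_ren_tm Γ Δ Θ (r : renaming Γ Δ) (q : renaming Δ Θ) σ (t : tm Γ σ) :
  ren_tm q (ren_tm r t) = ren_tm (fun σ v => q σ (r σ v)) t.
Proof. induction t; cbn; congruence. Qed.

Lemma sub_ren_tm Γ Δ Θ (r : renaming Γ Δ) (s : substitution Δ Θ) σ (t : tm Γ σ) :
  sub_tm s (ren_tm r t) = sub_tm (fun σ v => s σ (r σ v)) t.
Proof. induction t; cbn; congruence. Qed.

Lemma ren_sub_tm Γ Δ Θ (s : substitution Γ Δ) (r : renaming Δ Θ) σ (t : tm Γ σ) :
  ren_tm r (sub_tm s t) = sub_tm (fun σ v => ren_tm r (s σ v)) t.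
Proof. induction t; cbn; congruence. Qed.

Lemma sub_tm_Var Γ σ (t : tm Γ σ) : sub_tm (fun _ v => Var v) t = t.
Proof. induction t; cbn; congruence. Qed.

Lemma ren_up_lift_tm Γ Δ τ (r : renaming Γ Δ) σ (t : tm Γ σ) :
  ren_tm (@up_ren _ _ τ r) (lift_tm t) = lift_tm (ren_tm r t).
Proof. unfold lift_tm; now rewrite !ren_ren_tm. Qed.

Lemma sub_up_lift_tm Γ Δ τ (s : substitution Γ Δ) σ (t : tm Γ σ) :
  sub_tm (@up_sub _ _ τ s) (lift_tm t) = lift_tm (sub_tm s t).
Proof. unfold lift_tm; now rewrite sub_ren_tm, ren_sub_tm. Qed.

Lemma sub_single_lift_tm Γ τ (u : tm Γ τ) σ (t : tm Γ σ) :
  sub_tm (single u) (lift_tm t) = t.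
Proof. unfold lift_tm; rewrite sub_ren_tm; apply sub_tm_Var. Qed.

Lemma ren_eqf σ Γ Δ (r : renaming Γ Δ) (x y : tm Γ σ) :
  ren r (eqf x y) = eqf (ren_tm r x) (ren_tm r y).
Proof.
  revert Γ Δ r x y; induction σ as [|ρ _ τ IH]; intros; cbn; [easy|].
  rewrite IH; cbn; now rewrite !ren_up_lift_tm.
Qed.

Lemma sub_eqf σ Γ Δ (s : substitution Γ Δ) (x y : tm Γ σ) :
  sub s (eqf x y) = eqf (sub_tm s x) (sub_tm s y).
Proof.
  revert Γ Δ s x y; induction σ as [|ρ _ τ IH]; intros; cbn; [easy|].
  rewrite IH; cbn; now rewrite !sub_up_lift_tm.
Qed.

Lemma sub_maj σ Γ Δ (s : substitution Γ Δ) (x y : tm Γ σ) :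
  sub s (maj x y) = maj (sub_tm s x) (sub_tm s y).
Proof.
  revert Γ Δ s x y; induction σ as [|ρ IHρ τ IHτ]; intros; cbn; [easy|].
  rewrite IHρ, !IHτ; cbn; now rewrite !sub_up_lift_tm.
Qed.

(** * Derivations and provable equality *)

Ltac hyp := apply p_hyp; cbn; auto 10.

(** The rewrites push the substitution left by [p_allE] through [eqf] and cancel it against lifts,
    so that [d] can be specialised again. *)
Ltac spec d t :=
  let d' := fresh in
  pose proof (p_allE t d) as d'; clear d; rename d' into d;
  unfold inst in d; cbn in d;
  rewrite ?sub_eqf in d; cbn in d;
  rewrite ?sub_up_lift_tm, ?sub_single_lift_tm in d.

(** Carries computations in [EHAω] over to [DG], and from there to its extension. *)
Lemma prv_mono (T T' : theory) :
  (forall Γ (A : fm Γ), T Γ A -> T' Γ A) ->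
  forall Γ (H : list (fm Γ)) A, prv T H A -> prv T' H A.
Proof.
  intros i Γ H A d; induction d; eauto using prv.
Qed.

(** Provable equality as a relation on terms, so that combinator reductions become setoid
    rewriting. *)
Definition eqv {Γ} (H : list (fm Γ)) σ (x y : tm Γ σ) : Prop := prv EHAω H (eqf x y).

(** Equality at an arrow type is pointwise by definition, so this is an instantiation. *)
Lemma eqv_app_l Γ (H : list (fm Γ)) ρ σ (f g : tm Γ (ρ ~> σ)) t :
  eqv H _ f g -> eqv H _ (f @ t) (g @ t).
Proof. unfold eqv; cbn; intro d; spec d t; exact d. Qed.

(** This is where the extensionality axiom enters. *)
Lemma eqv_app_r Γ (H : list (fm Γ)) ρ σ (f : tm Γ (ρ ~> σ)) x y :
  eqv H _ x y -> eqv H _ (f @ x) (f @ y).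
Proof.
  intro e. pose proof (p_ax _ H _ (ext_ax _ ρ σ)) as d.
  spec d f; spec d x; spec d y. exact (p_impE d e).
Qed.

#[export] Instance eqv_refl Γ (H : list (fm Γ)) σ :
  Reflexive (eqv H σ).
Proof.
  revert Γ H; induction σ as [|ρ _ τ IH]; intros Γ H x.
  - pose proof (p_ax _ H _ (eq_refl0 _)) as d. spec d x. exact d.
  - apply p_allI, IH.
Qed.

(** The implication is internal so that, under the quantifier of an arrow type, the equation is at
    hand as a lifted hypothesis. *)
Lemma p_eqf_sym Γ (H : list (fm Γ)) σ (x y : tm Γ σ) :
  prv EHAω H (eqf x y ==> eqf y x).
Proof.
  revert Γ H x y; induction σ as [|ρ _ τ IH]; intros Γ H x y.
  - pose proof (p_ax _ H _ (eq_sym0 _)) as d. spec d x; spec d y. exact d.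
  - apply p_impI, p_allI.
    refine (p_impE (IH _ _ _ _) _).
    apply eqv_app_l, p_hyp; left. apply ren_eqf.
Qed.

Lemma p_eqf_trans Γ (H : list (fm Γ)) σ (x y z : tm Γ σ) :
  prv EHAω H (eqf x y ==> eqf y z ==> eqf x z).
Proof.
  revert Γ H x y z; induction σ as [|ρ _ τ IH]; intros Γ H x y z.
  - pose proof (p_ax _ H _ (eq_trans0 _)) as d.
    spec d x; spec d y; spec d z. exact d.
  - apply p_impI, p_impI, p_allI.
    refine (p_impE (p_impE (IH _ _ _ (lift_tm y @ v0) _) _) _);
      apply eqv_app_l, p_hyp; [right|]; left; apply ren_eqf.
Qed.

#[export] Instance eqv_equiv Γ (H : list (fm Γ)) σ :
  Equivalence (eqv H σ).
Proof.
  split.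
  - exact _.
  - intros x y e. exact (p_impE (p_eqf_sym _ H _ x y) e).
  - intros x y z e e'. exact (p_impE (p_impE (p_eqf_trans _ H _ x y z) e) e').
Qed.

#[export] Instance eqv_app Γ (H : list (fm Γ)) ρ σ :
  Morphisms.Proper
    (Morphisms.respectful (eqv H (ρ ~> σ))
      (Morphisms.respectful (eqv H ρ) (eqv H σ))) (@App Γ ρ σ).
Proof.
  intros f g e x y e'. transitivity (g @ x).
  - now apply eqv_app_l.
  - now apply eqv_app_r.
Qed.

Lemma eqv_Pi Γ (H : list (fm Γ)) ρ σ (x : tm Γ ρ) (y : tm Γ σ) :
  eqv H _ (Pi @ x @ y) x.
Proof.
  pose proof (p_ax _ H _ (pi_ax _ ρ σ)) as d. spec d x; spec d y. exact d.
Qed.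

Lemma eqv_Sigma Γ (H : list (fm Γ)) ρ σ τ
    (x : tm Γ (ρ ~> σ ~> τ)) (y : tm Γ (ρ ~> σ)) (z : tm Γ ρ) :
  eqv H _ (Sigma @ x @ y @ z) (x @ z @ (y @ z)).
Proof.
  pose proof (p_ax _ H _ (sigma_ax _ ρ σ τ)) as d.
  spec d x; spec d y; spec d z. exact d.
Qed.

Lemma eqv_Rec_Zero Γ (H : list (fm Γ)) ρ
    (x : tm Γ ρ) (y : tm Γ (ρ ~> N ~> ρ)) :
  eqv H _ (Rec @ Zero @ x @ y) x.
Proof.
  pose proof (p_ax _ H _ (rec_zero _ ρ)) as d. spec d x; spec d y. exact d.
Qed.

Lemma eqv_Rec_Succ Γ (H : list (fm Γ)) ρ
    (n : tm Γ N) (x : tm Γ ρ) (y : tm Γ (ρ ~> N ~> ρ)) :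
  eqv H _ (Rec @ (Succ @ n) @ x @ y) (y @ (Rec @ n @ x @ y) @ n).
Proof.
  pose proof (p_ax _ H _ (rec_succ _ ρ)) as d.
  spec d n; spec d x; spec d y. exact d.
Qed.

(** * Arithmetic of predecessor and truncated subtraction *)

Lemma Succ_neq_Zero Γ (H : list (fm Γ)) (n : tm Γ N) A :
  eqv H N (Succ @ n) Zero -> prv EHAω H A.
Proof.
  intro e. pose proof (p_ax _ H _ (succ_nonzero _)) as d. spec d n.
  exact (p_botE _ (p_impE d e)).
Qed.

Lemma p_induction Γ (H : list (fm Γ)) (φ : fm (N :: Γ)) :
  internal φ -> prv EHAω H (inst φ Zero) ->
  prv EHAω (φ :: map lift H) (step φ) -> prv EHAω H (All φ).
Proof.
  intros i b s. refine (p_impE (p_ax _ H _ (induction _ i)) _).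
  apply p_andI; [exact b|]. now apply p_allI, p_impI.
Qed.

(** Induction serves as a case distinction between zero and successor. It licenses the later
    intuitionistic split on the value of [φ]. *)
Lemma p_zero_dec Γ (H : list (fm Γ)) (n : tm Γ N) :
  prv EHAω H (n == Zero \/ (n == Zero ==> Bot)).
Proof.
  assert (d : prv EHAω H (@All Γ N (v0 == Zero \/ (v0 == Zero ==> Bot)))).
  { apply p_induction; [cbn; tauto| |].
    - apply p_orI1, (eqv_refl _ _ N).
    - apply p_orI2, p_impI. apply (Succ_neq_Zero _ _ v0). hyp. }
  spec d n. exact d.
Qed.

Lemma eqv_pred_Zero Γ (H : list (fm Γ)) :
  eqv H N (pred @ Zero) Zero.
Proof. unfold pred. now rewrite !eqv_Sigma, !eqv_Pi, eqv_Rec_Zero. Qed.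

Lemma eqv_pred_Succ Γ (H : list (fm Γ)) (n : tm Γ N) :
  eqv H N (pred @ (Succ @ n)) n.
Proof.
  unfold pred, idc.
  now rewrite !eqv_Sigma, !eqv_Pi, eqv_Rec_Succ, !eqv_Pi, eqv_Sigma, eqv_Pi.
Qed.

Lemma eqv_monus_Zero Γ (H : list (fm Γ)) (m : tm Γ N) :
  eqv H N (monus m Zero) m.
Proof. apply eqv_Rec_Zero. Qed.

Lemma eqv_monus_Succ Γ (H : list (fm Γ)) (m n : tm Γ N) :
  eqv H N (monus m (Succ @ n)) (pred @ (monus m n)).
Proof.
  unfold monus. rewrite eqv_Rec_Succ. unfold predc at 1.
  now rewrite eqv_Sigma, !eqv_Pi.
Qed.

(** Induction on [n], the argument on which [monus] recurses: the base case is [pred (m + 1) = m],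
    and each step applies [pred] to both sides. *)
Lemma eqv_monus_Succ_Succ Γ (H : list (fm Γ)) (m n : tm Γ N) :
  eqv H N (monus (Succ @ m) (Succ @ n)) (monus m n).
Proof.
  assert (d : prv EHAω H (All (monus (Succ @ lift_tm m) (Succ @ v0) == monus (lift_tm m) v0))).
  { apply p_induction; [cbn; tauto| |].
    - unfold inst; cbn; rewrite sub_single_lift_tm.
      change (eqv H N (monus (Succ @ m) (Succ @ Zero)) (monus m Zero)).
      now rewrite eqv_monus_Succ, !eqv_monus_Zero, eqv_pred_Succ.
    - unfold step, inst, lift1; cbn.
      rewrite ren_up_lift_tm, sub_single_lift_tm.
      change (ren_tm shift m) with (@lift_tm _ N _ m).
      match goal with |- prv _ ?H' _ => set (G := H');
      change (eqv G N (monus (Succ @ lift_tm m) (Succ @ (Succ @ v0)))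
        (monus (lift_tm m) (Succ @ v0))) end.
      rewrite eqv_monus_Succ, (eqv_monus_Succ _ _ (lift_tm m)).
      apply eqv_app_r. apply p_hyp; now left. }
  spec d n. exact d.
Qed.

Lemma eqv_Succ_monus Γ (H : list (fm Γ)) (n : tm Γ N) :
  eqv H N (monus (Succ @ n) n) (Succ @ Zero).
Proof.
  assert (d : prv EHAω H (@All Γ N (monus (Succ @ v0) v0 == Succ @ Zero))).
  { apply p_induction; [cbn; tauto| |].
    - apply eqv_monus_Zero.
    - match goal with |- prv _ ?H' _ => set (G := H');
      change (eqv G N (monus (Succ @ (Succ @ v0)) (Succ @ v0)) (Succ @ Zero)) end.
      rewrite eqv_monus_Succ_Succ. apply p_hyp; now left. }
  spec d n. exact d.
Qed.

(** * Characteristic functions of initial segments *)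

(* λk. if k = 0 then 1 else 0 *)
Definition is_zero {Γ} : tm Γ (N ~> N) :=
  Sigma @ (Sigma @ Rec @ (Pi @ (Succ @ Zero))) @ (Pi @ (Pi @ (Pi @ Zero))).

Lemma eqv_is_zero_Zero Γ (H : list (fm Γ)) :
  eqv H N (is_zero @ Zero) (Succ @ Zero).
Proof. unfold is_zero. now rewrite !eqv_Sigma, !eqv_Pi, eqv_Rec_Zero. Qed.

Lemma eqv_is_zero_Succ Γ (H : list (fm Γ)) (n : tm Γ N) :
  eqv H N (is_zero @ (Succ @ n)) Zero.
Proof. unfold is_zero. now rewrite !eqv_Sigma, !eqv_Pi, eqv_Rec_Succ, !eqv_Pi. Qed.

(** Subtracting 1 is taking [pred], which sends both possible values, 0 and 1, to 0. *)
Lemma le0_is_zero Γ (H : list (fm Γ)) (n : tm Γ N) :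
  eqv H N (monus (is_zero @ n) (Succ @ Zero)) Zero.
Proof.
  rewrite eqv_monus_Succ, eqv_monus_Zero.
  assert (d : prv EHAω H (@All Γ N (pred @ (is_zero @ v0) == Zero))).
  { apply p_induction; [cbn; tauto| |].
    - change (eqv H N (pred @ (is_zero @ Zero)) Zero).
      now rewrite eqv_is_zero_Zero, eqv_pred_Succ.
    - match goal with |- prv _ ?H' _ => set (G := H');
      change (eqv G N (pred @ (is_zero @ (Succ @ v0))) Zero) end.
      now rewrite eqv_is_zero_Succ, eqv_pred_Zero. }
  spec d n. exact d.
Qed.

(* λn. if n ≤ x then 1 else 0 *)
Definition upto {Γ} (x : tm Γ N) : tm Γ ty1 :=
  Sigma @ (Pi @ is_zero) @ (Sigma @ (Rec @ x) @ (Pi @ predc)).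

Lemma eqv_upto Γ (H : list (fm Γ)) (x n : tm Γ N) :
  eqv H N (upto x @ n) (is_zero @ (monus n x)).
Proof. unfold upto, monus. now rewrite !eqv_Sigma, !eqv_Pi. Qed.

(** Both conjuncts of majorization reduce to values at most 1 being compared with 1. *)
Lemma maj_upto Γ (H : list (fm Γ)) (x : tm Γ N) :
  prv EHAω H (maj (upto x) (Pi @ (Succ @ Zero) : tm Γ ty1)).
Proof.
  cbn. apply p_allI, p_allI, p_impI.
  match goal with |- prv _ ?H' (le0 (_ @ ?u) (_ @ ?v) /\ _) => set (G := H');
    enough (eqv G N (monus (upto (lift_tm (lift_tm x)) @ u) (Pi @ (Succ @ Zero) @ v)) Zero
      /\ eqv G N (monus (Pi @ (Succ @ Zero) @ u) (Pi @ (Succ @ Zero) @ v)) Zero)%type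
      as [? ?] by (now apply p_andI) end.
  (* Unfolding exposes applications, for which the congruence [eqv_app] is available. *)
  unfold monus at 1 2. rewrite !eqv_Pi, eqv_upto. fold (monus (Γ := N :: N :: Γ)).
  split.
  - apply le0_is_zero.
  (* To get [1 ≤ 1], the left 1 is written as [is_zero 0]. *)
  - apply (transitivity (y := monus (is_zero @ Zero) (Succ @ Zero))).
    + unfold monus. now rewrite eqv_is_zero_Zero.
    + apply le0_is_zero.
Qed.

Lemma upto_Succ Γ (H : list (fm Γ)) (x : tm Γ N) :
  prv EHAω H (upto x @ (Succ @ x) == Zero).
Proof.
  change (eqv H N (upto x @ (Succ @ x)) Zero).
  now rewrite eqv_upto, eqv_Succ_monus, eqv_is_zero_Succ.
Qed.

(** [le0 n x] is the equation [n - x = 0], so [upto x n] reduces to [is_zero 0 = 1]. *)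
Lemma upto_neq_Zero Γ (H : list (fm Γ)) (x n : tm Γ N) :
  prv EHAω H (le0 n x ==> upto x @ n == Zero ==> Bot).
Proof.
  apply p_impI, p_impI.
  match goal with |- prv _ ?H' _ => set (G := H') end.
  assert (e : eqv G N (monus n x) Zero) by hyp.
  assert (e' : eqv G N (upto x @ n) Zero) by hyp.
  apply (Succ_neq_Zero _ _ Zero).
  transitivity (upto x @ n); [|exact e'].
  now rewrite eqv_upto, e, eqv_is_zero_Zero.
Qed.

(** * Standardness *)

Lemma p_st_closed Γ (H : list (fm Γ)) σ (t : tm [] σ) :
  prv DG H (St (ren_tm (from_empty Γ) t)).
Proof. apply p_ax, st_closed. Qed.

Lemma p_st_maj Γ (H : list (fm Γ)) σ (x y : tm Γ σ) :
  prv DG H (St y) -> prv DG H (maj x y) -> prv DG H (St x).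
Proof.
  intros s m. pose proof (p_ax _ H _ (st_maj Γ σ)) as d.
  spec d x; rewrite ?sub_maj in d; cbn in d. spec d y; rewrite ?sub_maj in d; cbn in d.
  rewrite ?sub_up_lift_tm, ?sub_single_lift_tm in d.
  exact (p_impE (p_impE d s) m).
Qed.

(** The majorant is a closed term, hence standard, and standardness passes down along majorization,
    even when [x] is nonstandard. *)
Lemma st_upto Γ (H : list (fm Γ)) (x : tm Γ N) : prv DG H (St (upto x)).
Proof.
  apply (p_st_maj _ _ _ _ (Pi @ (Succ @ Zero))).
  - exact (p_st_closed _ _ _ (Pi @ (Succ @ Zero))).
  - exact (prv_mono _ _ base _ _ _ (maj_upto _ _ _)).
Qed.

Lemma p_st_Succ Γ (H : list (fm Γ)) (n : tm Γ N) :
  prv DG H (St n ==> St (Succ @ n)).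
Proof.
  pose proof (p_ax _ H _ (st_app Γ N N)) as d. spec d (Succ : tm Γ (N ~> N)); spec d n.
  exact (p_impE d (p_st_closed _ _ _ Succ)).
Qed.

(** * The standard [∃²] functional and the contradiction *)

(** The matrix of [exists2_st] for a term in any context, so that it can be restated by conversion
    after [φ] has been introduced. *)
Definition is_exists2 {Γ} (φ : tm Γ ty2) : fm Γ :=
  @AllSt Γ ty1 (@ExSt _ N (v1 @ v0 == Zero) <==> lift_tm φ @ v0 == Zero).

Lemma exists2_elim T Γ (H : list (fm Γ)) (φ : tm Γ ty2) (f : tm Γ ty1) :
  prv T H (is_exists2 φ) -> prv T H (St f) ->
  prv T H (@ExSt Γ N (lift_tm f @ v0 == Zero) <==> φ @ f == Zero).
Proof.
  intros d s. unfold is_exists2, AllSt in d. spec d f. exact (p_impE d s).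
Qed.

Theorem theorem3p8 : inconsistent (extend DG exists2_st).
Proof.
  set (T := extend DG exists2_st).
  assert (DG_T : forall Γ (H : list (fm Γ)) A, prv DG H A -> prv T H A)
    by (intros; now apply (prv_mono _ _ (@ext_old DG exists2_st))).
  assert (EHA_T : forall Γ (H : list (fm Γ)) A, prv EHAω H A -> prv T H A)
    by (intros; now apply DG_T, (prv_mono _ _ base)).
  refine (p_exE _ (p_ax T _ _ (@ext_new DG exists2_st [])) _).
  change (prv T [@St [ty2] _ v0 /\ is_exists2 v0] Bot).
  (* Here [v2] is the functional [φ], [v1] is [x] and [v0] is [n]. *)
  pose (Φ := (v2 @ upto v1 == Zero ==> upto v1 @ v0 == Zero) : fm [N; N; ty2]).
  refine (p_exE _ (p_impE (DG_T _ _ _ (p_ax _ _ _ (ax_R Φ))) _) _).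
  - apply p_allI.
    change (prv T [@St [N; ty2] _ v1 /\ is_exists2 v1] (ExSt Φ)).
    refine (p_orE (EHA_T _ _ _ (p_zero_dec _ _ (v1 @ upto v0))) _ _).
    (* If [φ (upto x) = 0], the equivalence read from right to left yields a standard zero of
       [upto x]. *)
    + refine (p_exE _ (p_impE (p_andE2 (exists2_elim _ _ _ v1 (upto v0) _ _)) _) _).
      * refine (p_andE2 _); hyp.
      * apply DG_T, st_upto.
      * hyp.
      * apply p_exI with (t := v0), p_andI.
        -- refine (p_andE1 _); hyp.
        -- apply p_impI. refine (p_andE2 _); hyp.
    (* Otherwise the premise of [Φ] is refutable and any standard number serves; 0 is a default. *)
    + apply p_exI with (t := Zero), p_andI.
      * apply DG_T, (p_st_closed _ _ _ Zero).
      * apply p_impI, p_botE.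
        refine (p_impE (A := v1 @ upto v0 == Zero) _ _); hyp.
  - change (prv T [(mon v0 /\ St v0) /\ All (ExMaj v1 (lift2 Φ));
      @St [N; ty2] _ v1 /\ is_exists2 v1] Bot).
    (* The bound [z] is now [v0], and it is also taken as the value of [x]; afterwards [v0] is [n],
       [v1] is [z] and [v2] is [φ]. *)
    refine (p_exE _ (p_allE (A := ExMaj v1 (lift2 Φ)) v0 _) _).
    { refine (p_andE2 _); hyp. }
    set (B := @All [N; N; ty2] N (ExMaj v2 (lift2 (lift2 Φ)))).
    change (prv T [le0 v0 v1 /\ Φ; (mon v1 /\ St v1) /\ B; St v2 /\ is_exists2 v2] Bot).
    match goal with |- prv _ ?H _ => set (G := H) end.
    assert (dn : prv T G (le0 v0 v1 /\ Φ)) by hyp.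
    assert (dz : prv T G ((mon v1 /\ St v1) /\ B)) by hyp.
    assert (dφ : prv T G (St v2 /\ is_exists2 v2)) by hyp.
    (* [n ≤ z] excludes [upto z n = 0], whereas [Φ] proves it once [φ (upto z) = 0] is known, which
       the equivalence read from left to right provides. *)
    refine (p_impE (p_impE (EHA_T _ _ _ (upto_neq_Zero _ _ v1 v0)) (p_andE1 dn))
      (p_impE (p_andE2 dn) (p_impE (p_andE1 (exists2_elim _ _ _ v2 (upto v1) (p_andE2 dφ) _)) _))).
    + apply DG_T, st_upto.
    (* The witness [z + 1] is the first zero of [upto z], and is standard because [z] is. *)
    + apply p_exI with (t := Succ @ v1), p_andI.
      * refine (p_impE (DG_T _ _ _ (p_st_Succ _ _ v1)) _).
        exact (p_andE2 (p_andE1 dz)).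
      * apply EHA_T, upto_Succ.
Qed.
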